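(* Suppose that there exist a continuously differentiable, uniformly bounded, uniformly coercive, and positive-definite operator $P(t)\in \mathscr{L}(X)$ defined for any $t\in\mathbb{R}_{\geq0}$, nonnegative and locally integrable functions $a_1(t), a_2(t)$ defined over $[0,+\infty)$ and satisfying \begin{align*} \lim_{t\rightarrow +\infty}\int_0^t a_1(\tau)\,{\rm d}\tau=+\infty\quad \text{and}\quad a_2(t)\leq M a_1(t) \end{align*} with a constant $M\geq 0$, constants $m_1,m_2>2$, and a function $\zeta \in\mathcal{K}$, such that \begin{align*} \langle ( A^*(t)P(t)+P(t)A(t)+\dot{P}(t))x , x\rangle+2\langle F(t, x, u), P(t)x \rangle \leq -a_1(t)\|x\|^2_{X}+ a_2(t) \left(\|x\|^{m_1}_X +\|x\|^{m_2}_X \right)+ \zeta(\|u\|_{U}), \quad \forall x\in D(A),\ u\in U,\ t\in\mathbb{R}_{\geq 0}. \end{align*} Then $V(t,x):=\langle P(t)x, x \rangle$ is an LiISS Lyapunov functional (LiISS-LF), and therefore the system $\dot x(t)=A(t)x(t)+F(t,x(t),u(t))$, $x(0)=x_0$ is LiISS. In particular, if $a_2\equiv 0$ on $[0,+\infty)$, then $V(t,x):=\langle P(t)x, x \rangle$ is an iISS Lyapunov functional (iISS-LF), and hence the system is iISS.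
   Context: $X$ is a Hilbert space with inner product $\langle\cdot,\cdot\rangle$ and norm $\|\cdot\|_X=\sqrt{\langle\cdot,\cdot\rangle}$, $U\subset X$ is a normed linear space with norm $\|\cdot\|_U$, and $\mathscr{L}(X)$ denotes the space of bounded linear operators on $X$. Consider the non-autonomous system $\dot{x}(t)=A(t)x(t)+F(t,x(t),u(t))$, $t\geq 0$, $x(0)=x_0$, where for each $t\geq0$ the linear operator $A(t):D(A(t))\subset X\to X$ generates an analytic semigroup on $X$ (with adjoint $A^*(t)$), $X_\alpha$ ($\alpha\in[0,1)$) is the fractional power space of $-A(t)$ with norm $\|(-A(t))^\alpha x\|_X$, $F:\mathbb{R}_{>0}\times X_\alpha\times U\to X$, $x_0\in D(A(0))$, and inputs $u\in C(\mathbb{R}_{\geq0},U)$; solutions are classical solutions. $\mathcal{K}$ is the class of continuous, strictly increasing functions $\gamma:\mathbb{R}_{\ge0}\to\mathbb{R}_{\ge0}$ with $\gamma(0)=0$; $\mathcal{K}_\infty$ the unbounded ones; $\mathcal{KL}$ the usual class. The system is LiISS if there exist $R>0$, $\gamma_0,\gamma\in\mathcal{K}$, $\sigma_0,\sigma\in\mathcal{K}_\infty$, $\beta\in\mathcal{KL}$ such that $\|x(t,x_0,u)\|_X\le\beta(\|x_0\|_X,t)+\sigma(\int_0^t\gamma(\|u(s)\|_U)ds)$ for all $t\ge0$ whenever $x_0\in D(A(0))$, $u\in C(\mathbb{R}_{\ge0},U)$ satisfy $\|x_0\|_X+\sigma_0(\int_0^t\gamma_0(\|u(s)\|_U)ds)\le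 R$ for all $t>0$; it is iISS if this estimate holds for all such $(x_0,u)$. A continuously differentiable $V:\mathbb{R}_{\ge0}\times X\to\mathbb{R}_{\ge0}$ is an LiISS-LF if (i) $\alpha_1(\|x\|_X)\le V(t,x)\le\alpha_2(\|x\|_X)$ for some $\alpha_1,\alpha_2\in\mathcal{K}_\infty$, and (ii) there exist nonnegative locally integrable $g_1,g_2$ with $\int_0^t g_1\to+\infty$ and $g_2\le g_1$, $\theta_1,\theta_2\in\mathcal{K}$ with $\theta_2(s)\le\theta_1(s)$ on some $[0,R']$, $R'>0$, and $\phi\in\mathcal{K}$ such that along trajectories $\dot V(t,x)\le -g_1(t)\theta_1(\|x\|_X)+g_2(t)\theta_2(\|x\|_X)+\phi(\|u(t)\|_U)$; it is an iISS-LF if additionally $g_2\equiv0$. *)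

(* Defs.v *)
From HB Require Import structures.
From mathcomp Require Import all_boot all_order all_algebra.
From mathcomp Require Import all_classical all_reals all_analysis.
Set Implicit Arguments. Unset Strict Implicit. Unset Printing Implicit Defensive.
Import Order.TTheory GRing.Theory Num.Theory.
Import numFieldNormedType.Exports.
Local Open Scope classical_set_scope.
Local Open Scope ring_scope.

Section Defs.
Variable R : realType.

Definition class_K (g : R -> R) : Prop :=
  [/\ g 0 = 0,
      {within `[0, +oo[, continuous g} &
      (forall s t, 0 <= s -> s < t -> g s < g t)].

Definition class_Kinf (g : R -> R) : Prop :=
  class_K g /\ (forall M, exists s, 0 <= s /\ M < g s).

Definition class_KL (b : R -> R -> R) : Prop :=
  [/\ {within [set p : R * R | 0 <= p.1 /\ 0 <= p.2],
         continuous (fun p : R * R => b p.1 p.2)},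
      (forall t, 0 <= t -> class_K (fun s => b s t)),
      (forall s t1 t2, 0 <= s -> 0 <= t1 -> t1 <= t2 -> b s t2 <= b s t1) &
      (forall s, 0 <= s -> b s t @[t --> +oo] --> 0)].

Definition int0 (f : R -> R) (t : R) : R :=
  Rintegral (@lebesgue_measure R) `[0, t] f.

Definition nonneg_locint (a : R -> R) : Prop :=
  (forall t, 0 <= t -> 0 <= a t) /\
  (forall t, 0 <= t ->
     (@lebesgue_measure R).-integrable `[0, t] (fun s => (a s)%:E)).

Definition int_diverges (a : R -> R) : Prop :=
  int0 a t @[t --> +oo] --> +oo.

Section Hilbert.
Variable X : completeNormedModType R.

(** ip is a (real) inner product inducing the norm of X, so (X, ip) is a real
    Hilbert space (X is complete). *)
Definition is_inner_product (ip : X -> X -> R) : Prop :=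
  [/\ (forall x y, ip x y = ip y x),
      (forall a x y z, ip (a *: x + y) z = a * ip x z + ip y z) &
      (forall x, ip x x = `|x| ^+ 2)].

Definition bounded_linear (L : X -> X) : Prop :=
  (forall a x y, L (a *: x + y) = a *: L x + L y) /\
  (exists C, forall x, `|L x| <= C * `|x|).

Definition C0_semigroup (T : R -> X -> X) : Prop :=
  [/\ (forall t, 0 <= t -> bounded_linear (T t)),
      (forall x, T 0 x = x),
      (forall t s x, 0 <= t -> 0 <= s -> T (t + s) x = T t (T s x)) &
      (forall x, T h x @[h --> 0^'+] --> x)].

Definition is_generator (T : R -> X -> X) (D : set X) (A : X -> X) : Prop :=
  forall x, D x <->
    (h^-1 *: (T h x - x) @[h --> 0^'+] --> A x).

(** A (with domain D) generates an analytic semigroup: generator of a C0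
    semigroup T with T(t) X included in D for t > 0 and
    sup_{0<t<=1} t |A T(t)| < oo  (Pazy, Thm 2.5.2 (d)). *)
Definition generates_analytic_semigroup (D : set X) (A : X -> X) : Prop :=
  exists T : R -> X -> X,
    [/\ C0_semigroup T, is_generator T D A,
        (forall t x, 0 < t -> D (T t x)) &
        (exists C, forall t x, 0 < t -> t <= 1 ->
            t * `|A (T t x)| <= C * `|x|)].

Section System.
Variable U : normedModType R.
Variables (DA : R -> set X) (A : R -> X -> X) (F : R -> X -> U -> X).

Definition classical_solution (x0 : X) (u : R -> U) (x : R -> X) : Prop :=
  [/\ x 0 = x0,
      {within `[0, +oo[, continuous x} &
      (forall t, 0 < t -> [/\ DA t (x t), derivable x t 1,
          {for t, continuous (derive1 x)} &
          derive1 x t = A t (x t) + F t (x t) (u t)])].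

Definition admissible_input (u : R -> U) : Prop :=
  {within `[0, +oo[, continuous u}.

Definition LiISS : Prop :=
  exists (Rr : R) (g0 g : R -> R) (s0 s : R -> R) (b : R -> R -> R),
    [/\ 0 < Rr, class_K g0, class_K g, class_Kinf s0 & class_Kinf s] /\
     (class_KL b /\
      forall x0 u x, DA 0 x0 -> admissible_input u ->
        classical_solution x0 u x ->
        (forall t, 0 < t -> `|x0| + s0 (int0 (fun r => g0 `|u r|) t) <= Rr) ->
        forall t, 0 <= t ->
          `|x t| <= b `|x0| t + s (int0 (fun r => g `|u r|) t)).

Definition iISS : Prop :=
  exists (g : R -> R) (s : R -> R) (b : R -> R -> R),
    [/\ class_K g, class_Kinf s, class_KL b &
      forall x0 u x, DA 0 x0 -> admissible_input u ->
        classical_solution x0 u x ->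
        forall t, 0 <= t ->
          `|x t| <= b `|x0| t + s (int0 (fun r => g `|u r|) t)].

(** V : R_{>=0} x X -> R_{>=0} continuously (Frechet) differentiable on
    [0,oo) x X (one-sided in t at t = 0): partial derivatives Vt, Vx exist,
    Vx t x is a bounded linear functional, and both are continuous
    (Vx in operator norm). *)
Definition C1_on_halfspace (V : R -> X -> R) : Prop :=
  exists (Vt : R -> X -> R) (Vx : R -> X -> X -> R),
  [/\ (forall t x, 0 <= t ->
         (forall a h k, Vx t x (a *: h + k) = a * Vx t x h + Vx t x k) /\
         (exists C, forall h, `|Vx t x h| <= C * `|h|)),
      (forall t x, 0 <= t -> forall e : R, 0 < e -> exists2 d : R, 0 < d &
         forall s h, 0 <= t + s -> `|s| < d -> `|h| < d ->
           `|V (t + s) (x + h) - V t x - s * Vt t x - Vx t x h|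
             <= e * (`|s| + `|h|)) &
      (forall t x, 0 <= t -> forall e : R, 0 < e -> exists2 d : R, 0 < d &
         forall t' x', 0 <= t' -> `|t' - t| < d -> `|x' - x| < d ->
           `|Vt t' x' - Vt t x| <= e /\
           (forall h, `|Vx t' x' h - Vx t x h| <= e * `|h|))].

Definition LF_sandwich (V : R -> X -> R) : Prop :=
  (forall t x, 0 <= t -> 0 <= V t x) /\
  exists a1 a2, [/\ class_Kinf a1, class_Kinf a2 &
    forall t x, 0 <= t -> a1 `|x| <= V t x <= a2 `|x|].

Definition dissipation_along (V : R -> X -> R) (W : R -> X -> R -> R) : Prop :=
  forall x0 u x, DA 0 x0 -> admissible_input u ->
    classical_solution x0 u x ->
    forall t, 0 < t ->
      derivable (fun r => V r (x r)) t 1 /\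
      derive1 (fun r => V r (x r)) t <= W t (x t) `|u t|.

Definition LiISS_LF (V : R -> X -> R) : Prop :=
  [/\ C1_on_halfspace V, LF_sandwich V &
    exists (g1 g2 th1 th2 phi : R -> R) (R' : R),
      [/\ nonneg_locint g1, nonneg_locint g2, int_diverges g1,
          (forall t, 0 <= t -> g2 t <= g1 t) &
       [/\ class_K th1, class_K th2, 0 < R',
           (forall s, 0 <= s -> s <= R' -> th2 s <= th1 s) & class_K phi] /\
           dissipation_along V (fun t y w =>
              - g1 t * th1 `|y| + g2 t * th2 `|y| + phi w)]].

Definition iISS_LF (V : R -> X -> R) : Prop :=
  [/\ C1_on_halfspace V, LF_sandwich V &
    exists (g1 th1 phi : R -> R),
      [/\ nonneg_locint g1, int_diverges g1, class_K th1, class_K phi &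
          dissipation_along V (fun t y w => - g1 t * th1 `|y| + phi w)]].

End System.
End Hilbert.
End Defs.

(* Main.v *)
Require Import Defs.
From HB Require Import structures.
From mathcomp Require Import all_boot all_order all_algebra.
From mathcomp Require Import all_classical all_reals all_analysis.
From mathcomp Require Import ring lra.
Set Implicit Arguments.
Unset Strict Implicit.
Unset Printing Implicit Defensive.
Import Order.TTheory GRing.Theory Num.Theory.
Import numFieldNormedType.Exports.
Local Open Scope classical_set_scope.
Local Open Scope ring_scope.

(** Along a classical solution, [v t = V t (x t)] is [C^1] for [t > 0] and, as
    long as [|x t|] is so small that the superquadratic terms are absorbed by
    half of [a1 |x|^2], it satisfies [v' <= - a v + z] with [a] proportional to
    [a1] and [z = zeta |u|].  A Gronwall argument with the merely integrable
    weight [a] can be avoided.  The function [w = v - \int z] is nonincreasing,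
    so [v >= w t] on [[0, t]]; integrating [v' <= z - a (w t)] gives
    [w t * (1 + \int_0^t a) <= v 0] when [w t >= 0], hence
    [v t <= v 0 / (1 + \int_0^t a) + \int_0^t z].
    As [\int a] diverges, the first term decays, and taking square roots yields
    the KL bound [sqrt (C / c) |x0| / sqrt (1 + \int_0^t a)].  For small data
    the same bound keeps [v] below the level where the absorption is valid. *)

(** Explicit radii give control up to the boundary point [0], where no two-sided neighbourhood stays
    inside the half-line. *)
Lemma within_continuous_normP (R : realType) (V W : normedModType R)
    (D : set V) (f : V -> W) :
  {within D, continuous f} <->
  (forall x, D x -> forall e : R, 0 < e -> exists2 d : R, 0 < d &
     forall y, D y -> `|y - x| < d -> `|f y - f x| < e).
Proof.
split=> [/subspace_continuousP cf x Dx e e0|cf].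
  have /cvgrPdist_lt/(_ e e0) := cf x Dx.
  rewrite /within/= => /nbhs_normP[d /= d0 H]; exists d => // y Dy yx.
  by rewrite distrC; apply: H => //=; rewrite /ball_/= distrC.
apply/subspace_continuousP => x Dx; apply/cvgrPdist_lt => e e0.
have [d d0 H] := cf x Dx e e0.
apply/nbhs_normP; exists d => //= y; rewrite /ball_/= => yx Dy.
by rewrite distrC; apply: H => //; rewrite distrC.
Qed.

(** * Functions on the half-line and their running integrals *)

Section halfline.
Variable R : realType.
Implicit Types (f g : R -> R) (t : R).

(** The outer function is continuous only on [[0, +oo[]; nonnegativity of [f] keeps its values
    there. This covers class K functions of norms and the time factor of the KL bound. *)
Lemma within_continuous_comp_nonneg (V : normedModType R) (D : set V)
    (f : V -> R) g :
  {within D, continuous f} -> (forall x, D x -> 0 <= f x) ->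
  {within `[0, +oo[, continuous g} -> {within D, continuous (g \o f)}.
Proof.
move=> /within_continuous_normP cf f0 /within_continuous_normP cg.
apply/within_continuous_normP => x Dx e e0.
have fx0 : `[0, +oo[%classic (f x) by rewrite /= in_itv/= f0.
have [d d0 H] := cg _ fx0 e e0.
have [d' d'0 H'] := cf x Dx d d0.
exists d' => // y Dy yx; apply: H; last exact: H'.
by rewrite /= in_itv/= f0.
Qed.

Lemma class_K_ge0 f t : class_K f -> 0 <= t -> 0 <= f t.
Proof.
move=> [f0 _ fS]; rewrite le_eqVlt => /predU1P[<-|t0]; first by rewrite f0.
by rewrite -f0 ltW// fS.
Qed.

Lemma class_K_comp_norm_locint (U : normedModType R) (u : R -> U) g :
  class_K g -> {within `[0, +oo[, continuous u} ->
  nonneg_locint (fun r => g `|u r|).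
Proof.
move=> Kg cu; split=> [t _|t t0]; first exact: class_K_ge0.
have c : {within `[0, +oo[, continuous (fun r => g `|u r|)}.
  case: Kg => _ cg _.
  apply: (@within_continuous_comp_nonneg _ _ (fun r => `|u r|)) => //.
  apply/within_continuous_normP => r r0 e e0.
  move/within_continuous_normP: cu => /(_ r r0 e e0)[d d0 H].
  exists d => // s s0 sr; exact: le_lt_trans (ler_dist_dist _ _) (H s s0 sr).
have c' : {within `[0, t], continuous (fun r => g `|u r|)}.
  by apply: continuous_subspaceW c; exact: subset_itvl.
exact: continuous_compact_integrable (@segment_compact _ _ _) c'.
Qed.

Lemma int0_0 f : int0 f 0 = 0.
Proof. by rewrite /int0 set_itv1 Rintegral_set1. Qed.

Lemma int0_ge0 f t : nonneg_locint f -> 0 <= int0 f t.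
Proof.
move=> [f0 _]; apply: Rintegral_ge0 => x /=.
by rewrite in_itv/= => /andP[x0 _]; exact: f0.
Qed.

Lemma nonneg_locint_itv f s t : nonneg_locint f -> 0 <= s -> 0 <= t ->
  (@lebesgue_measure R).-integrable `]s, t] (EFin \o f).
Proof.
move=> [_ fi] s0 t0; apply: integrableS (fi t t0) => //=.
by move=> x /=; rewrite !in_itv/= => /andP[/ltW sx ->]; rewrite (le_trans s0).
Qed.

Lemma int0B f s t : nonneg_locint f -> 0 <= s -> s <= t ->
  int0 f t - int0 f s = Rintegral (@lebesgue_measure R) `]s, t] f.
Proof.
move=> [_ fi] s0 st; rewrite /int0 Rintegral_itvB ?bnd_simp//.
exact: fi (le_trans s0 st).
Qed.

Lemma le_int0 f s t : nonneg_locint f -> 0 <= s -> s <= t ->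
  int0 f s <= int0 f t.
Proof.
move=> fi s0 st; rewrite -subr_ge0 int0B//; apply: Rintegral_ge0 => x /=.
by rewrite in_itv/= => /andP[sx _]; apply: fi.1; rewrite (le_trans s0)// ltW.
Qed.

Lemma int0_continuous f : nonneg_locint f ->
  {within `[0, +oo[, continuous (int0 f)}.
Proof.
move=> [_ fi]; apply/within_continuous_normP => x /=; rewrite in_itv/= andbT.
move=> x0 e e0.
(* The integral is continuous on compact intervals; [[0, x + 1]] contains every point of the
   half-line within distance [1] of [x]. *)
have x10 : 0 <= x + 1 by rewrite addr_ge0.
have := parameterized_integral_continuous x10 (fi _ x10).
have xi : `[0, x + 1]%classic x by rewrite /= in_itv/= x0 lerDl ler01.
move=> /within_continuous_normP/(_ x xi e e0)[d d0 H].
exists (Num.min d 1); first by rewrite lt_min d0 ltr01.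
move=> y; rewrite /= in_itv/= andbT => y0; rewrite lt_min => /andP[yd y1].
apply: H => //=; rewrite in_itv/= y0/=.
by move: y1; rewrite ltr_norml => /andP[_]; rewrite ltrBlDl => /ltW.
Qed.

Lemma nonneg_locintZ (k : R) f : 0 <= k -> nonneg_locint f ->
  nonneg_locint (fun r => k * f r).
Proof.
move=> k0 [f0 fi]; split=> t t0; first by rewrite mulr_ge0// f0.
by apply: eq_integrable (integrableZl _ k (fi t t0)) => //= x _; rewrite EFinM.
Qed.

Lemma int0Z (k : R) f t : nonneg_locint f -> 0 <= t ->
  int0 (fun r => k * f r) t = k * int0 f t.
Proof. by move=> [_ fi] t0; rewrite /int0 RintegralZl//; exact: fi. Qed.

End halfline.

(** * A scalar comparison principle with an integrable weight *)

Section comparison.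
Variables (R : realType) (v a z : R -> R).
Hypothesis cv : {within `[0, +oo[, continuous v}.
Hypothesis dv : forall t : R, 0 < t -> derivable v t 1.
Hypothesis cdv : forall t : R, 0 < t -> {for t, continuous (derive1 v)}.

Lemma continuous_derivable_pos t : 0 < t -> {for t, continuous v}.
Proof. by move=> t0; apply/differentiable_continuous/derivable1_diffP/dv. Qed.

(** Derivatives are controlled only at positive times, so inequalities are first proved for [s > 0];
    continuity then carries them to time zero. *)
Lemma nonpos_at0 (f : R -> R) (t : R) : {within `[0, +oo[, continuous f} ->
  0 < t -> (forall s, 0 < s -> s < t -> f s <= 0) -> f 0 <= 0.
Proof.
move=> /within_continuous_normP cf t0 fs; rewrite leNgt; apply/negP => f0.
have [|d d0 H] := cf 0 _ (f 0) f0; first by rewrite /= in_itv/= lexx.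
pose s := Num.min d t / 2.
have m0 : 0 < Num.min d t by rewrite lt_min d0.
have s0 : 0 < s by rewrite divr_gt0.
have [sd st] : s < d /\ s < t.
  by apply/andP; rewrite -lt_min /s ltr_pdivrMr// mulr_natr mulr2n ltrDl.
have := H s; rewrite /= in_itv/= (ltW s0) subr0 gtr0_norm// => /(_ erefl sd).
rewrite ltr_norml => /andP[+ _]; rewrite ltrBDl subrr ltNge.
by rewrite (fs _ s0 st).
Qed.

(** Since [0 < s], [derive1 v] is continuous on [[s, t]] and the fundamental theorem of calculus
    applies; the weight [a] enters only through monotonicity of the integral. In use, [k] is [0] or
    a lower bound for [v]. *)
Lemma increment_le (k : R) (s t : R) : nonneg_locint a -> nonneg_locint z ->
  0 < s -> s <= t ->
  (forall r, s < r -> r <= t -> derive1 v r <= z r - k * a r) ->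
  v t - v s <= (int0 z t - int0 z s) - k * (int0 a t - int0 a s).
Proof.
move=> ai zi s0; rewrite le_eqVlt => /predU1P[<-|st] H.
  by rewrite !subrr mulr0.
have cdv' : {within `[s, t], continuous (derive1 v)}.
  apply: continuous_in_subspaceT => r; rewrite inE/= in_itv/= => /andP[sr _].
  exact/cdv/(lt_le_trans s0).
have s0' := ltW s0; have st' := ltW st; have t0 := le_trans s0' st'.
have dvi : (@lebesgue_measure R).-integrable `]s, t] (EFin \o derive1 v).
  have : (@lebesgue_measure R).-integrable `[s, t] (EFin \o derive1 v).
    by apply: continuous_compact_integrable => //; exact: segment_compact.
  by apply: integrableS => //; apply: subset_itvr; rewrite bnd_simp.
have FTC : Rintegral (@lebesgue_measure R) `]s, t] (derive1 v) = v t - v s.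
  rewrite Rintegral_itv_obnd_cbnd// /Rintegral.
  rewrite (@continuous_FTC2 _ (derive1 v) v)//.
  split=> [r|  |].
  - by rewrite in_itv/= => /andP[sr _]; apply/dv/(lt_trans s0).
  - exact/cvg_at_right_filter/continuous_derivable_pos.
  - exact/cvg_at_left_filter/continuous_derivable_pos/(lt_le_trans s0).
have zI := nonneg_locint_itv zi s0' t0.
have aI := nonneg_locint_itv ai s0' t0.
have kaI : (@lebesgue_measure R).-integrable `]s, t]
    (EFin \o (fun r => k * a r)).
  by apply: eq_integrable (integrableZl _ k aI) => //= r _; rewrite EFinM.
rewrite -FTC !int0B// -RintegralZl// -RintegralB//.
apply: le_Rintegral => //.
- by apply: eq_integrable (integrableB _ zI kaI) => //= r _; rewrite EFinB.
- by move=> r /=; rewrite in_itv/= => /andP[sr rt]; exact: H.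
Qed.

Lemma comparison_le (T : R) : nonneg_locint a -> nonneg_locint z ->
  (forall t, 0 <= t -> 0 <= v t) ->
  (forall r, 0 < r -> r <= T -> derive1 v r <= z r - a r * v r) ->
  forall t, 0 <= t -> t <= T -> v t <= v 0 / (1 + int0 a t) + int0 z t.
Proof.
move=> ai zi v0 H t; rewrite le_eqVlt => /predU1P[<- _|t0 tT].
  by rewrite !int0_0 !addr0 divr1.
pose w s := v s - int0 z s.
have wS s : 0 < s -> s <= t -> w t <= w s.
  move=> s0 st.
  (* Taking [k = 0], that is, dropping the nonnegative damping [a r * v r], makes [w]
     nonincreasing. *)
  have : v t - v s <= int0 z t - int0 z s - 0 * (int0 a t - int0 a s).
    apply: increment_le => // r sr rt.
    have r0 := lt_trans s0 sr.
    rewrite mul0r subr0 (le_trans (H r r0 (le_trans rt tT)))// gerBl.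
    by rewrite mulr_ge0 ?v0 ?ai.1// ltW.
  rewrite /w; lra.
have I0 : 0 < 1 + int0 a t by rewrite ltr_pwDl// int0_ge0.
have [wt0|wt0] := lerP (w t) 0.
  rewrite -lerBlDr (le_trans wt0)// divr_ge0 ?v0// ltW//.
rewrite -lerBlDr ler_pdivlMr// -subr_le0.
(* Integrating over []s, t]] with [v] replaced by [w t] in the damping gives [f s <= 0] for [s > 0];
   the case [s = 0] is the goal. *)
pose f s := w t * (1 + (int0 a t - int0 a s)) - w s.
have -> : (v t - int0 z t) * (1 + int0 a t) - v 0 = f 0.
  by rewrite /f /w !int0_0 !subr0.
apply: (@nonpos_at0 f t) => // [|s s0 st].
  have ca := int0_continuous ai; have cz := int0_continuous zi.
  move=> s; apply: cvgB.
    apply: cvgM; first exact: cvg_cst.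
    apply: cvgD; first exact: cvg_cst.
    by apply: cvgB; [exact: cvg_cst|exact: ca].
  by apply: cvgB; [exact: cv|exact: cz].
have : v t - v s <= int0 z t - int0 z s - w t * (int0 a t - int0 a s).
  apply: increment_le => //; first exact: ltW.
  move=> r sr rt; have r0 := lt_trans s0 sr.
  rewrite (le_trans (H r r0 (le_trans rt tT)))// lerD2l lerN2 mulrC.
  rewrite ler_wpM2l ?ai.1 ?(ltW r0)// (le_trans (wS r r0 rt))// /w gerBl.
  exact: int0_ge0.
rewrite /f; have wE r : w r = v r - int0 z r by [].
by move: (wE t) (wE s); move: (w t) (w s) => wt ws; lra.
Qed.

(* Bootstrapping: the differential inequality is only assumed below the level
   [rho], and the bound it gives prevents [v] from ever reaching [rho]. *)
Lemma comparison_le_sublevel (rho : R) : nonneg_locint a -> nonneg_locint z ->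
  (forall t, 0 <= t -> 0 <= v t) ->
  (forall r, 0 < r -> v r <= rho -> derive1 v r <= z r - a r * v r) ->
  (forall t, 0 <= t -> v 0 + int0 z t < rho) ->
  forall t, 0 <= t -> v t <= v 0 / (1 + int0 a t) + int0 z t.
Proof.
move=> ai zi v0 H hrho.
have small t : 0 <= t -> v 0 / (1 + int0 a t) + int0 z t < rho.
  move=> t0; apply: le_lt_trans (hrho t t0).
  rewrite lerD2r ler_piMr ?v0// invf_le1 ?lerDl ?ltr_pwDl//; exact: int0_ge0.
suff vrho t : 0 <= t -> v t < rho.
  move=> t t0; apply: (@comparison_le t) => // r r0 _.
  by apply: H => //; rewrite ltW// vrho// ltW.
move=> t0; rewrite ltNge; apply/negP => vt.
(* [inf S] is the first time at which [v] reaches [rho]; the bound evaluated there gives the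
   contradiction. *)
pose S := [set s : R | 0 <= s /\ rho <= v s].
have hS : has_inf S by split; [exists t|exists 0 => s []].
have T0 : 0 <= inf S by apply: lb_le_inf; [exists t|move=> s []].
have below s : 0 <= s -> s < inf S -> v s < rho.
  move=> s0 sT; rewrite ltNge; apply/negP => vs.
  by have := ge_inf hS.2 (conj s0 vs : S s); rewrite leNgt sT.
(* The infimum is attained: if [v (inf S) < rho], continuity would keep [v] below [rho] near
   [inf S], where [S] has points. *)
have vT : rho <= v (inf S).
  rewrite leNgt; apply/negP => vT.
  have e0 : 0 < rho - v (inf S) by rewrite subr_gt0.
  have Ti : `[0, +oo[%classic (inf S) by rewrite /= in_itv/= T0.
  move/within_continuous_normP: cv => /(_ _ Ti _ e0)[d d0 Hd].
  have [s [s0 vs] sT] := inf_adherent d0 hS.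
  have Ts : inf S <= s by apply: ge_inf; [exact: hS.2|].
  have := Hd s; rewrite /= in_itv/= s0 ger0_norm ?subr_ge0// ltrBlDl sT.
  move=> /(_ erefl erefl); rewrite ltr_norml => /andP[_].
  by rewrite ltrBDr subrK ltNge vs.
have : v (inf S) <= v 0 / (1 + int0 a (inf S)) + int0 z (inf S).
  have [{}T0|T0'] := eqVneq (inf S) 0.
    by rewrite T0 !int0_0 !addr0 divr1.
  apply: (@comparison_le (inf S)) => // r r0.
  rewrite le_eqVlt => /predU1P[rT|rT].
    (* At the endpoint itself [v <= rho] is still required; it follows by left continuity from the
       earlier values below [rho]. The maximum with [0] keeps the test point [s] in the
       half-line. *)
    apply: H => //; rewrite rT leNgt; apply/negP => rhov.
    have e0 : 0 < v (inf S) - rho by rewrite subr_gt0.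
    have Ti : `[0, +oo[%classic (inf S) by rewrite /= in_itv/= T0.
    move/within_continuous_normP: cv => /(_ _ Ti _ e0)[d d0 Hd].
    have Tgt0 : 0 < inf S by rewrite lt_def T0' T0.
    pose s := Num.max 0 (inf S - d / 2).
    have s0 : 0 <= s by rewrite le_max lexx.
    have sT : s < inf S by rewrite gt_max Tgt0 ltrBlDr ltrDl divr_gt0.
    have ds : inf S - d / 2 <= s by rewrite le_max lexx orbT.
    have sd : `|s - inf S| < d by rewrite ltr0_norm ?subr_lt0//; lra.
    have := Hd s; rewrite /= in_itv/= s0 => /(_ erefl sd).
    by rewrite ltr_norml => /andP[]; have := below s s0 sT; lra.
  by apply: H => //; rewrite ltW// below// ltW.
by rewrite leNgt (lt_le_trans (small _ T0)).
Qed.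

End comparison.

(** * Comparison functions: powers, square roots and the KL bound *)

Section comparison_functions.
Variable R : realType.
Implicit Types (k m s t : R) (a : R -> R).

Lemma powR_within_continuous m : 0 < m ->
  {within `[0, +oo[, continuous (fun s => s `^ m)}.
Proof.
move=> m0; apply/continuous_within_itvcyP; split=> [x|].
  move=> x0; apply/differentiable_continuous/derivable1_diffP.
  exact: derivable_powR.
by rewrite powR0 ?gt_eqF//; exact: powR_cvg0.
Qed.

Lemma class_Kinf_sqr k : 0 < k -> class_Kinf (fun s => k * s ^+ 2).
Proof.
move=> k0; split; last first.
  (* With [q = |N| / k], expanding [k * (1 + q) ^+ 2] gives [2 * |N|] plus a positive remainder,
     hence a value above [N]. *)
  move=> N; have [q q0 qk] : exists2 q : R, 0 <= q & k * q = `|N|.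
    by exists (`|N| / k); [rewrite divr_ge0// ltW|rewrite mulrC divfK ?gt_eqF].
  exists (1 + q); split; first by rewrite addr_ge0.
  have kq2 : 0 <= k * q ^+ 2 by rewrite mulr_ge0 ?sqr_ge0// ltW.
  by have := normr_ge0 N; have := ler_norm N; lra.
split; first by rewrite expr0n mulr0.
  apply: continuous_subspaceT => s; apply: cvgM; first exact: cvg_cst.
  exact: exprn_continuous.
move=> s t s0 st; rewrite ltr_pM2l// ltrXn2r// lt_eqF//.
Qed.

Lemma class_Kinf_id : class_Kinf (fun s : R => s).
Proof.
split; last first.
  move=> N; exists (`|N| + 1).
  by split; have := ler_norm N; have := normr_ge0 N; lra.
by split=> //; apply: continuous_subspaceT => s; exact: cvg_id.
Qed.

Lemma class_Kinf_sqrt k : 0 < k -> class_Kinf (fun s => Num.sqrt (k * s)).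
Proof.
move=> k0; split; last first.
  move=> N; exists ((`|N| + 1) ^+ 2 / k); split.
    by rewrite divr_ge0 ?sqr_ge0// ltW.
  rewrite mulrC divfK ?gt_eqF// sqrtr_sqr ger0_norm ?addr_ge0//.
  by have := ler_norm N; lra.
split; first by rewrite mulr0 sqrtr0.
  apply: continuous_subspaceT => s.
  apply: (@continuous_comp _ _ _ (fun s => k * s) Num.sqrt).
    by apply: cvgM; [exact: cvg_cst|exact: cvg_id].
  exact: sqrt_continuous.
by move=> s t s0 st; rewrite ltr_sqrt ?ltr_pM2l// mulr_gt0// (le_lt_trans s0).
Qed.

Lemma class_K_powR_sum k m1 m2 : 0 < k -> 0 < m1 -> 0 < m2 ->
  class_K (fun s => k * (s `^ m1 + s `^ m2)).
Proof.
move=> k0 m10 m20; split.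
- by rewrite !powR0 ?gt_eqF// addr0 mulr0.
- move=> s; apply: cvgM; first exact: cvg_cst.
  by apply: cvgD; exact: powR_within_continuous.
- move=> s t s0 st; rewrite ltr_pM2l// ltrD// gt0_ltr_powR// nnegrE//.
    exact: le_trans (ltW st).
  exact: le_trans (ltW st).
Qed.

(** Factoring out [s ^+ 2] leaves a power of exponent [m - 2 > 0], which tends to zero with [s];
    each of the two terms is made at most half of [s ^+ 2]. *)
Lemma powR_sum_le_sqr k m1 m2 : 0 < k -> 2 < m1 -> 2 < m2 ->
  exists2 r : R, 0 < r &
    forall s, 0 <= s -> s <= r -> k * (s `^ m1 + s `^ m2) <= s ^+ 2.
Proof.
move=> k0 m12 m22; pose e := (2 * k)^-1.
have e0 : 0 < e by rewrite invr_gt0 mulr_gt0.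
have near_small m : 2 < m -> \forall r \near (0 : R)^'+, r `^ (m - 2) < e.
  move=> m_gt2; have p0 : 0 < m - 2 by rewrite subr_gt0.
  exact: cvgr_lt (powR_cvg0 p0) _ e0.
near (0 : R)^'+ => r.
have r0 : 0 < r by [].
exists r => // s s0 sr.
have term m : 2 < m -> r `^ (m - 2) < e -> k * s `^ m <= s ^+ 2 / 2.
  move=> m_gt2 rm.
  have -> : s `^ m = s `^ (m - 2) * s ^+ 2.
    rewrite -powR_mulrn// -powRD ?subrK//.
    by apply/implyP; rewrite gt_eqF// (lt_trans _ m_gt2).
  have : s `^ (m - 2) <= e.
    apply: ltW; apply: le_lt_trans rm; apply: ge0_ler_powR => //.
      by rewrite subr_ge0 ltW.
    by rewrite nnegrE ltW.
  have ke : k * e = 2^-1 by rewrite /e invfM mulrCA mulfV ?gt_eqF// mulr1.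
  have := sqr_ge0 s; move: (s `^ (m - 2)) (s ^+ 2) => p q q0 pe.
  by rewrite mulrA [leRHS]mulrC ler_wpM2r// -ke ler_wpM2l// ltW.
have t1 : k * s `^ m1 <= s ^+ 2 / 2.
  by apply: term => //; near: r; exact: near_small.
have t2 : k * s `^ m2 <= s ^+ 2 / 2.
  by apply: term => //; near: r; exact: near_small.
by rewrite mulrDr; lra.
Unshelve. all: by end_near. Qed.

Lemma int_divergesZ k a : 0 < k -> nonneg_locint a -> int_diverges a ->
  int_diverges (fun r => k * a r).
Proof.
move=> k0 ai /cvgryPgt aoo; apply/cvgryPgt => N.
near=> t; rewrite int0Z// mulrC -ltr_pdivrMr//; near: t; exact: aoo.
Unshelve. all: by end_near. Qed.

(** This is the decay left by the comparison principle after a square root. Monotonicity in time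
    comes from [a >= 0], convergence to zero from the divergence of the integral; the summand [1]
    keeps the denominator positive at time zero. *)
Lemma class_KL_inv_sqrt_int k a : 0 < k -> nonneg_locint a ->
  int_diverges a -> class_KL (fun s t => k * s / Num.sqrt (1 + int0 a t)).
Proof.
move=> k0 ai aoo.
have J0 t : 0 < 1 + int0 a t by rewrite ltr_pwDl// int0_ge0.
have sJ0 t : 0 < Num.sqrt (1 + int0 a t) by rewrite sqrtr_gt0.
split.
- have cJ : {within `[0, +oo[,
      continuous (fun t => (Num.sqrt (1 + int0 a t))^-1)}.
    have ca := int0_continuous ai.
    move=> t; apply: cvgV; first by rewrite gt_eqF.
    apply: continuous_cvg; first exact: sqrt_continuous.
    by apply: cvgD; [exact: cvg_cst|exact: ca].
  pose D := [set p : R * R | 0 <= p.1 /\ 0 <= p.2].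
  have c2 : {within D, continuous (fun p : R * R => p.2)}.
    by apply: continuous_subspaceT => p; exact: cvg_snd.
  have c1 : {within D, continuous (fun p : R * R => k * p.1)}.
    apply: continuous_subspaceT => p; apply: cvgM; first exact: cvg_cst.
    exact: cvg_fst.
  have D0 p : D p -> 0 <= p.2 by case.
  have cc := @within_continuous_comp_nonneg _ _ D _ _ c2 D0 cJ.
  by move=> p; apply: cvgM; [exact: c1|exact: cc].
- move=> t t0; split; first by rewrite mulr0 mul0r.
    apply: continuous_subspaceT => s; apply: cvgM; last exact: cvg_cst.
    by apply: cvgM; [exact: cvg_cst|exact: cvg_id].
  by move=> s r s0 sr; rewrite ltr_pM2r ?invr_gt0// ltr_pM2l.
- move=> s t1 t2 s0 t10 t12; rewrite ler_wpM2l ?mulr_ge0 ?(ltW k0)//.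
  by rewrite lef_pV2 ?posrE// ler_wsqrtr// lerD2l le_int0.
- move=> s s0; apply/cvgrPdist_lt => e e0.
  near=> t.
  rewrite sub0r normrN ger0_norm; last first.
    by rewrite divr_ge0 ?mulr_ge0 ?(ltW k0)// ?(ltW (sJ0 _)).
  rewrite ltr_pdivrMr// [ltRHS]mulrC -ltr_pdivrMr//.
  (* The goal is now [k * s / e < Num.sqrt (1 + int0 a t)]; after squaring, divergence of the
     integral supplies it. *)
  have q0 : 0 <= k * s / e by rewrite divr_ge0 ?mulr_ge0// ltW.
  rewrite -(ger0_norm q0) -sqrtr_sqr ltr_sqrt//.
  apply: (@lt_trans _ _ (int0 a t)); last by rewrite ltrDr.
  by near: t; move/cvgryPgt: aoo; exact.
Unshelve. all: by end_near. Qed.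

End comparison_functions.

(** * Chain rule for [V r (y r)] along a curve [y] *)

Section chain_rule.
Variable R : realType.

Lemma ler_norm_split (W : normedZmodType R) (a b c : W) :
  `|a| <= `|a - b - c| + `|b| + `|c|.
Proof.
have {1}-> : a = (a - b - c) + c + b by rewrite !subrK.
by rewrite addrAC (le_trans (ler_normD _ _))// lerD2r ler_normD.
Qed.

(** The quotient-free form allows [h = 0] and composes directly with the remainder estimate for
    [V]. *)
Lemma derive1_littleoP (W : normedModType R) (f : R -> W) (t : R) (l : W) :
  (derivable f t 1 /\ derive1 f t = l) <->
  (forall e : R, 0 < e -> exists2 d : R, 0 < d &
     forall h, `|h| < d -> `|f (t + h) - f t - h *: l| <= e * `|h|).
Proof.
have key : (derivable f t 1 /\ derive1 f t = l) <->
    (h^-1 *: (f (h + t) - f t) @[h --> 0^'] --> l).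
  rewrite /derivable /derive1 /=; under eq_fun do rewrite scaler1.
  split=> [[cf <-]//|cf]; split; last exact: cvg_lim.
  by apply/cvg_ex; exists l.
rewrite key; split=> [cf e e0|H].
  move/cvgrPdist_le : cf => /(_ e e0) /nbhs_normP[d /= d0 Hd].
  exists d => // h hd; have [->|h0] := eqVneq h 0.
    by rewrite addr0 subrr sub0r scale0r oppr0 !normr0 mulr0.
  have := Hd h; rewrite /ball_/= sub0r normrN => /(_ hd h0) hle.
  have -> : f (t + h) - f t - h *: l = - (h *: (l - h^-1 *: (f (h + t) - f t))).
    rewrite scalerBr scalerA mulfV// scale1r opprB.
    by rewrite (addrC t).
  by rewrite normrN normrZ mulrC ler_wpM2r.
apply/cvgrPdist_le => e e0; have [d d0 Hd] := H e e0.
apply/nbhs_normP; exists d => //= h; rewrite /ball_/= sub0r normrN => hd h0.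
have -> : l - h^-1 *: (f (h + t) - f t) =
    - (h^-1 *: (f (t + h) - f t - h *: l)).
  by rewrite [in RHS]scalerBr scalerA mulVf// scale1r opprB (addrC t).
rewrite normrN normrZ normfV mulrC ler_pdivrMr ?normr_gt0//; exact: Hd.
Qed.

Variables (X : normedModType R) (V Vt : R -> X -> R) (Vx : R -> X -> X -> R).
Hypothesis Vx_lin : forall (t : R) x, 0 <= t ->
  (forall a h k, Vx t x (a *: h + k) = a * Vx t x h + Vx t x k) /\
  (exists C : R, forall h, `|Vx t x h| <= C * `|h|).
Hypothesis V_diff : forall (t : R) x, 0 <= t ->
  forall e : R, 0 < e -> exists2 d : R, 0 < d &
    forall s h, 0 <= t + s -> `|s| < d -> `|h| < d ->
      `|V (t + s) (x + h) - V t x - s * Vt t x - Vx t x h|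
        <= e * (`|s| + `|h|).
Hypothesis V_C1 : forall (t : R) x, 0 <= t ->
  forall e : R, 0 < e -> exists2 d : R, 0 < d &
    forall (t' : R) x', 0 <= t' -> `|t' - t| < d -> `|x' - x| < d ->
      `|Vt t' x' - Vt t x| <= e /\
      (forall h, `|Vx t' x' h - Vx t x h| <= e * `|h|).

(** A strictly positive constant can be divided by in the choice of radii. *)
Lemma differential_bound (t : R) x : 0 <= t ->
  exists2 C : R, 0 < C & forall h, `|Vx t x h| <= C * `|h|.
Proof.
move=> t0; have [_ [C HC]] := @Vx_lin t x t0.
exists (`|C| + 1); first by rewrite ltr_pwDr.
move=> h; apply: le_trans (HC h) _; rewrite ler_wpM2r//.
by have := ler_norm C; lra.
Qed.

Lemma differentialB (t : R) x h k : 0 <= t ->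
  Vx t x (h - k) = Vx t x h - Vx t x k.
Proof.
by move=> t0; rewrite addrC -scaleN1r (Vx_lin x t0).1 mulN1r addrC.
Qed.

Lemma differentialZ (t : R) x a h : 0 <= t -> Vx t x (a *: h) = a * Vx t x h.
Proof.
move=> t0; have [Vlin _] := Vx_lin x t0.
have V0 : Vx t x 0 = 0.
  by have := differentialB x 0 0 t0; rewrite subrr subrr.
by rewrite -[a *: h]addr0 Vlin V0 addr0.
Qed.

Lemma comp_within_continuous (y : R -> X) :
  {within `[0, +oo[, continuous y} ->
  {within `[0, +oo[, continuous (fun r => V r (y r))}.
Proof.
move=> /within_continuous_normP cy; apply/within_continuous_normP => t ti e e0.
have t0 : 0 <= t by move: ti; rewrite /= in_itv/= andbT.
have [C C0 HC] := differential_bound (y t) t0.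
have [d d0 Hd] := V_diff (y t) t0 ltr01.
(* [K] dominates the factors of both [|s - t|] and [|y s - y t|] in the increment of [V], whose
   remainder is taken with tolerance [1]; each share is then below [e / 2]. *)
pose K := C + `|Vt t (y t)| + 2.
have K0 : 0 < K by rewrite /K; have := normr_ge0 (Vt t (y t)); lra.
pose dm := Num.min d (e / (2 * K)).
have dm0 : 0 < dm by rewrite lt_min d0 divr_gt0// mulr_gt0.
have [d' d'0 Hd'] := cy t ti dm dm0.
exists (Num.min d' dm); first by rewrite lt_min d'0.
move=> s si; rewrite lt_min => /andP[sd' sdm].
have s0 : 0 <= s by move: si; rewrite /= in_itv/= andbT.
have := Hd' s si sd'; move: sdm.
rewrite /dm !lt_min => /andP[sd se] /andP[yd ye].
have := Hd (s - t) (y s - y t); rewrite !subrKC => /(_ s0 sd yd).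
have := HC (y s - y t).
move: se ye; rewrite !ltr_pdivlMr ?mulr_gt0//.
move: (s - t) (y s - y t) => p q pe qe Vq Vd.
have tri : `|V s (y s) - V t (y t)| <=
    `|V s (y s) - V t (y t) - p * Vt t (y t) - Vx t (y t) q|
      + `|p| * `|Vt t (y t)| + `|Vx t (y t) q|.
  by rewrite -normrM; exact: ler_norm_split.
apply: le_lt_trans tri _.
have p0 := normr_ge0 p; have q0 := normr_ge0 q.
have v0 := normr_ge0 (Vt t (y t)).
rewrite /K in pe qe.
have h1 : 0 <= `|p| * C by rewrite mulr_ge0// ltW.
have h2 : 0 <= `|q| * `|Vt t (y t)| by rewrite mulr_ge0.
lra.
Qed.

Lemma comp_derive1 (y : R -> X) (t : R) : 0 < t -> derivable y t 1 ->
  derivable (fun r => V r (y r)) t 1 /\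
  derive1 (fun r => V r (y r)) t = Vt t (y t) + Vx t (y t) (derive1 y t).
Proof.
move=> t0 dy; have t0' := ltW t0.
have /derive1_littleoP dyE := conj dy (erefl (derive1 y t)).
apply/derive1_littleoP => e e0.
have [C C0 HC] := differential_bound (y t) t0'.
set y' := derive1 y t in dyE *.
(* [K * |h|] bounds [|h|] plus the increment of [y]. Half of [e] pays for the remainder of [V], half
   for the image under [Vx] of the remainder of [y]; the [1] in the minimum below bounds the latter
   remainder by [|h|]. *)
pose K := `|y'| + 2.
have K0 : 0 < K by rewrite /K; have := normr_ge0 y'; lra.
have e1 : 0 < e / (2 * K) by rewrite divr_gt0// mulr_gt0.
have [d d0 Hd] := V_diff (y t) t0' e1.
have e2 : 0 < Num.min 1 (e / (2 * C)).
  by rewrite lt_min ltr01 divr_gt0// mulr_gt0.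
have [d' d'0 Hd'] := dyE _ e2.
(* The bound [t] on [|h|] keeps [t + h] in the half-line. *)
exists (Num.min t (Num.min d' (d / K))).
  by rewrite !lt_min t0 d'0 divr_gt0.
move=> h; rewrite !lt_min => /and3P[ht hd' hd].
have th : 0 <= t + h by move: ht; rewrite ltr_norml => /andP[]; lra.
have h0 := normr_ge0 h; have y0 := normr_ge0 y'.
set q := y (t + h) - y t - h *: y' in Hd' *.
have qh : `|q| <= `|h| /\ `|q| <= e / (2 * C) * `|h|.
  split; apply: le_trans (Hd' h hd') _.
    by rewrite ler_piMl// ge_min lexx.
  by rewrite ler_wpM2r// ge_min lexx orbT.
have ph : `|y (t + h) - y t| <= (`|y'| + 1) * `|h|.
  rewrite -[y (t + h) - y t](subrK (h *: y')) -/q.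
  by rewrite (le_trans (ler_normD _ _))// normrZ; lra.
have hK : `|h| * K < d by rewrite -ltr_pdivlMr.
have pd : `|y (t + h) - y t| < d.
  by apply: le_lt_trans hK; apply: le_trans ph _; rewrite /K; lra.
have hd2 : `|h| < d.
  apply: le_lt_trans hK; rewrite ler_peMr// /K; lra.
have := Hd h (y (t + h) - y t) th hd2 pd; rewrite subrKC.
have -> : Vx t (y t) (y (t + h) - y t) = Vx t (y t) q + h * Vx t (y t) y'.
  by rewrite -differentialZ// /q [in RHS]differentialB// subrK.
move=> HV.
have -> : V (t + h) (y (t + h)) - V t (y t)
    - h *: (Vt t (y t) + Vx t (y t) y') =
    (V (t + h) (y (t + h)) - V t (y t) - h * Vt t (y t)
      - (Vx t (y t) q + h * Vx t (y t) y')) + Vx t (y t) q.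
  by rewrite /GRing.scale/=; ring.
apply: le_trans (ler_normD _ _) _.
have -> : e * `|h| = e / (2 * K) * (K * `|h|) + C * (e / (2 * C) * `|h|).
  by field; rewrite !gt_eqF.
apply: lerD.
  apply: le_trans HV _; rewrite ler_wpM2l ?(ltW e1)// /K; lra.
by apply: le_trans (HC q) _; rewrite ler_wpM2l ?(ltW C0)// qh.2.
Qed.

(** The comparison principle needs this continuity in order to integrate the derivative. *)
Lemma comp_derive1_continuous (y : R -> X) (t : R) : 0 < t ->
  (forall r, 0 < r -> derivable y r 1) -> {for t, continuous (derive1 y)} ->
  {for t, continuous (derive1 (fun r => V r (y r)))}.
Proof.
move=> t0 dy cy'; have t0' := ltW t0.
have cy : {for t, continuous y}.
  by apply/differentiable_continuous/derivable1_diffP/dy.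
have ct : {for t, continuous (fun r : R => r)} by exact: cvg_id.
apply/cvgrPdist_le => /= e e0.
have [C C0 HC] := differential_bound (y t) t0'.
pose K := `|derive1 y t| + 2.
have K0 : 0 < K by rewrite /K; have := normr_ge0 (derive1 y t); lra.
have e1 : 0 < e / (2 * K) by rewrite divr_gt0// mulr_gt0.
have e2 : 0 < e / (2 * C) by rewrite divr_gt0// mulr_gt0.
have [d d0 Hd] := V_C1 (y t) t0' e1.
near=> r.
have r0 : 0 < r by near: r; exact: lt_nbhsr.
have rt : `|r - t| < d.
  by rewrite distrC; near: r; move/cvgrPdist_lt : ct; exact.
have yrt : `|y r - y t| < d.
  by rewrite distrC; near: r; move/cvgrPdist_lt : cy; exact.
have y'1 : `|derive1 y r - derive1 y t| <= 1.
  by rewrite distrC; near: r; move/cvgrPdist_le : cy'; exact.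
have y'2 : `|derive1 y r - derive1 y t| <= e / (2 * C).
  by rewrite distrC; near: r; move/cvgrPdist_le : cy'; exact.
rewrite distrC (comp_derive1 t0 (dy t t0)).2 (comp_derive1 r0 (dy r r0)).2.
have [Hd1 Hd2] := Hd r (y r) (ltW r0) rt yrt.
have y'K : 1 + `|derive1 y r| <= K.
  have := ler_normD (derive1 y r - derive1 y t) (derive1 y t).
  by rewrite subrK /K; lra.
(* Telescoping: the change of the time derivative, the change of the functional on one vector, and
   the functional at [t] on the change of vector. *)
have -> : Vt r (y r) + Vx r (y r) (derive1 y r)
    - (Vt t (y t) + Vx t (y t) (derive1 y t)) =
  (Vt r (y r) - Vt t (y t))
    + (Vx r (y r) (derive1 y r) - Vx t (y t) (derive1 y r))
    + Vx t (y t) (derive1 y r - derive1 y t).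
  by rewrite differentialB//; ring.
have -> : e = e / (2 * K) * K + C * (e / (2 * C)).
  by field; rewrite !gt_eqF.
apply: le_trans (ler_normD _ _) _; apply: lerD; last first.
  by apply: le_trans (HC _) _; rewrite ler_wpM2l// ltW.
apply: le_trans (ler_normD _ _) _.
apply: le_trans (lerD Hd1 (Hd2 _)) _.
by rewrite -[X in X + _]mulr1 -mulrDr ler_wpM2l// ltW.
Unshelve. all: by end_near. Qed.

End chain_rule.

(** * Differentiability of the quadratic form [ip (P t x) x] *)

Section quadratic_form.
Variables (R : realType) (X : completeNormedModType R) (ip : X -> X -> R).
Hypothesis ipP : is_inner_product ip.

Lemma ipC x y : ip x y = ip y x. Proof. by case: ipP. Qed.

Lemma ip_norm x : ip x x = `|x| ^+ 2. Proof. by case: ipP. Qed.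

Lemma ipDl x y z : ip (x + y) z = ip x z + ip y z.
Proof. by case: ipP => _ lin _; rewrite -[x]scale1r lin scale1r mul1r. Qed.

Lemma ip0l z : ip 0 z = 0.
Proof. by have := ipDl 0 0 z; rewrite addr0 -{1}[ip 0 z]addr0 => /addrI <-. Qed.

Lemma ipZl a x z : ip (a *: x) z = a * ip x z.
Proof. by case: ipP => _ lin _; rewrite -[_ *: _]addr0 lin ip0l addr0. Qed.

Lemma ipNl x z : ip (- x) z = - ip x z.
Proof. by rewrite -scaleN1r ipZl mulN1r. Qed.

Lemma ipBl x y z : ip (x - y) z = ip x z - ip y z.
Proof. by rewrite ipDl ipNl. Qed.

Lemma ipDr x y z : ip z (x + y) = ip z x + ip z y.
Proof. by rewrite ipC ipDl !(ipC z). Qed.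

Lemma ipZr a x z : ip z (a *: x) = a * ip z x.
Proof. by rewrite ipC ipZl (ipC z). Qed.

Lemma ipBr x y z : ip z (x - y) = ip z x - ip z y.
Proof. by rewrite ipC ipBl !(ipC z). Qed.

(** For [y != 0], the squared norm of [|y| ^+ 2 *: x - ip x y *: y] is nonnegative and equals
    [|y| ^+ 2] times the gap between the squares of the two sides. *)
Lemma ip_CauchySchwarz x y : `|ip x y| <= `|x| * `|y|.
Proof.
have [->|y0] := eqVneq y 0; first by rewrite ipC ip0l !normr0 mulr0.
have ny : 0 < `|y| by rewrite normr_gt0.
rewrite -(ler_pXn2r (_ : 0 < 2)%N) ?nnegrE ?mulr_ge0// real_normK ?num_real//.
have : 0 <= ip (`|y| ^+ 2 *: x - ip x y *: y) (`|y| ^+ 2 *: x - ip x y *: y).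
  by rewrite ip_norm sqr_ge0.
rewrite !(ipBl, ipBr, ipZl, ipZr) !ip_norm (ipC y x).
move: (ip x y) => c.
rewrite [leRHS](_ : _ = `|y| ^+ 2 * ((`|x| * `|y|) ^+ 2 - c ^+ 2)); last first.
  by ring.
by rewrite pmulr_rge0 ?exprn_gt0// subr_ge0.
Qed.

Lemma ip_le x y (p q : R) : `|x| <= p -> `|y| <= q -> `|ip x y| <= p * q.
Proof.
by move=> xp yq; apply: le_trans (ip_CauchySchwarz x y) _; rewrite ler_pM.
Qed.

Lemma bounded_linearD (L : X -> X) x y : bounded_linear L ->
  L (x + y) = L x + L y.
Proof. by case=> lin _; rewrite -[x]scale1r lin !scale1r. Qed.

Lemma bounded_linear_bound (L : X -> X) : bounded_linear L ->
  exists2 C : R, 0 < C & forall x, `|L x| <= C * `|x|.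
Proof.
case=> _ [C HC]; exists (`|C| + 1); first by rewrite ltr_pwDr.
move=> h; apply: le_trans (HC h) _; rewrite ler_wpM2r//.
by have := ler_norm C; lra.
Qed.

Variables P Pdot : R -> X -> X.
Hypothesis P_lin : forall t : R, 0 <= t -> bounded_linear (P t).
Hypothesis P_sym : forall (t : R) x y, 0 <= t -> ip (P t x) y = ip x (P t y).
Hypothesis Pdot_lin : forall t : R, 0 <= t -> bounded_linear (Pdot t).
Hypothesis P_diff : forall t : R, 0 <= t ->
  forall e : R, 0 < e -> exists2 d : R, 0 < d &
    forall s x, 0 <= t + s -> `|s| < d ->
      `|P (t + s) x - P t x - s *: Pdot t x| <= e * `|s| * `|x|.
Hypothesis Pdot_cont : forall t : R, 0 <= t ->
  forall e : R, 0 < e -> exists2 d : R, 0 < d &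
    forall (s : R) x, 0 <= s -> `|s - t| < d ->
      `|Pdot s x - Pdot t x| <= e * `|x|.

Let V (t : R) (x : X) : R := ip (P t x) x.
Let Vt (t : R) (x : X) : R := ip (Pdot t x) x.
Let Vx (t : R) (x h : X) : R := 2 * ip (P t x) h.

Lemma quadratic_Vx_linear (t : R) x : 0 <= t ->
  (forall a h k, Vx t x (a *: h + k) = a * Vx t x h + Vx t x k) /\
  (exists C : R, forall h, `|Vx t x h| <= C * `|h|).
Proof.
move=> t0; split=> [a h k|]; first by rewrite /Vx ipDr ipZr; ring.
exists (2 * `|P t x|) => h; rewrite /Vx normrM ger0_norm// -mulrA.
by rewrite ler_wpM2l// ip_CauchySchwarz.
Qed.

(** The two mixed terms stay separate because the identity serves both [P t] and [Pdot t], and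
    self-adjointness is stated for the former only. *)
Lemma quadratic_increment (L : X -> X) x h : bounded_linear L ->
  ip (L (x + h)) (x + h) - ip (L x) x = ip (L x) h + ip (L h) x + ip (L h) h.
Proof. by move=> lL; rewrite bounded_linearD// !(ipDl, ipDr); ring. Qed.

Lemma quadratic_differentiable (t : R) x : 0 <= t ->
  forall e : R, 0 < e -> exists2 d : R, 0 < d &
    forall s h, 0 <= t + s -> `|s| < d -> `|h| < d ->
      `|V (t + s) (x + h) - V t x - s * Vt t x - Vx t x h|
        <= e * (`|s| + `|h|).
Proof.
move=> t0 e e0.
have [C C0 HC] := bounded_linear_bound (P_lin t0).
have [D D0 HD] := bounded_linear_bound (Pdot_lin t0).
(* [L] bounds the norm of [x + h] as soon as [|h| < 1]. *)
have [L L1 xL] : exists2 L : R, 1 <= L & `|x| = L - 1.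
  by exists (`|x| + 1); [rewrite lerDr|rewrite addrK].
have L0 : 0 < L by lra.
have e1 : 0 < e / (2 * L ^+ 2) by rewrite divr_gt0// mulr_gt0// exprn_gt0.
have [d d0 Hd] := P_diff t0 e1.
(* The remainder consists of [ip (P t h) h], of [s] times the increment of the [Pdot t] form, and of
   the error [E] paired with [y]. The radius [e / C] makes the first at most [e * |h|];
   [e / (4 * D * L)] and [d] make each of the others at most [e / 2 * |s|]. *)
exists (Num.min (Num.min 1 d) (Num.min (e / C) (e / (4 * D * L)))).
  by rewrite !lt_min ltr01 d0 !divr_gt0// !mulr_gt0.
move=> s h ts; rewrite !lt_min => /andP[/andP[_ sd] _].
move=> /andP[/andP[h1 _] /andP[hC hD]].
set y := x + h.
have yL : `|y| <= L by apply: le_trans (ler_normD _ _) _; rewrite xL; lra.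
have HE := Hd s y ts sd.
set E := P (t + s) y - P t y - s *: Pdot t y in HE.
have -> : V (t + s) y - V t x - s * Vt t x - Vx t x h =
    ip (P t h) h + s * (ip (Pdot t x) h + ip (Pdot t h) x + ip (Pdot t h) h)
     + ip E y.
  have PE : P (t + s) y = E + s *: Pdot t y + P t y by rewrite /E !subrK.
  rewrite /V PE !ipDl ipZl -quadratic_increment -/y; last exact: Pdot_lin.
  have := quadratic_increment x h (P_lin t0); rewrite -/y /Vt /Vx.
  by rewrite (P_sym h x t0) (ipC h); lra.
have h0 := normr_ge0 h; have s0 := normr_ge0 s.
have b1 : `|ip (P t h) h| <= e * `|h|.
  apply: le_trans (ip_le (HC h) (lexx _)) _; rewrite ler_wpM2r//.
  by move: hC; rewrite ltr_pdivlMr// mulrC => /ltW.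
have b2 : `|s * (ip (Pdot t x) h + ip (Pdot t h) x + ip (Pdot t h) h)|
    <= `|s| * (e / 2).
  rewrite normrM ler_wpM2l//.
  have c1 := ip_le (HD x) (lexx `|h|).
  have c2 := ip_le (HD h) (lexx `|x|).
  have c3 := ip_le (HD h) (lexx `|h|).
  have : `|ip (Pdot t x) h + ip (Pdot t h) x + ip (Pdot t h) h| <=
      D * `|x| * `|h| + D * `|h| * `|x| + D * `|h| * `|h|.
    apply: le_trans (ler_normD _ _) (lerD _ c3).
    exact: le_trans (ler_normD _ _) (lerD c1 c2).
  move=> /le_trans; apply.
  move: hD; rewrite ltr_pdivlMr ?mulr_gt0// xL => hD.
  have : D * `|h| * `|h| <= D * `|h| * 1.
    by rewrite ler_wpM2l ?(ltW h1)// mulr_ge0// ltW.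
  have : 0 <= D * `|h| by rewrite mulr_ge0// ltW.
  by lra.
have b3 : `|ip E y| <= e / 2 * `|s|.
  apply: le_trans (ip_le HE (lexx _)) _.
  have -> : e / 2 * `|s| = e / (2 * L ^+ 2) * `|s| * L * L.
    by field; rewrite gt_eqF.
  have q0 : 0 <= e / (2 * L ^+ 2) * `|s| by rewrite mulr_ge0// ltW.
  by apply: ler_pM => //; [exact: mulr_ge0|exact: ler_wpM2l].
apply: le_trans (ler_normD _ _) _; apply: le_trans (lerD _ b3) _.
  exact: le_trans (ler_normD _ _) (lerD b1 b2).
lra.
Qed.

Lemma quadratic_C1 (t : R) x : 0 <= t ->
  forall e : R, 0 < e -> exists2 d : R, 0 < d &
    forall (t' : R) x', 0 <= t' -> `|t' - t| < d -> `|x' - x| < d ->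
      `|Vt t' x' - Vt t x| <= e /\
      (forall h, `|Vx t' x' h - Vx t x h| <= e * `|h|).
Proof.
move=> t0 e e0.
have [C C0 HC] := bounded_linear_bound (P_lin t0).
have [D D0 HD] := bounded_linear_bound (Pdot_lin t0).
have [L L1 xL] : exists2 L : R, 1 <= L & `|x| = L - 1.
  by exists (`|x| + 1); [rewrite lerDr|rewrite addrK].
have L0 : 0 < L by lra.
have e1 : 0 < e / (2 * L ^+ 2) by rewrite divr_gt0// mulr_gt0// exprn_gt0.
have [d d0 Hd] := Pdot_cont t0 e1.
(* Tolerance [1] gives a Lipschitz estimate for [P] at [t] with constant [1 + D]. The constant [K]
   then serves twice: for this time increment and for the increment of the [Pdot t] form. *)
have [d' d'0 Hd'] := P_diff t0 ltr01.
pose K := 4 * (D + 1) * L.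
have D1 : 0 < D + 1 by lra.
have K0 : 0 < K by rewrite /K !mulr_gt0.
exists (Num.min (Num.min 1 (Num.min d d')) (Num.min (e / (4 * C)) (e / K))).
  by rewrite !lt_min ltr01 d0 d'0 !divr_gt0// !mulr_gt0.
move=> t' x' t'0; rewrite !lt_min.
move=> /andP[/and3P[s1 sd sd'] /andP[_ sK]].
move=> /andP[/andP[h1 _] /andP[hC hK]].
have [h xE] : exists h, x' = x + h by exists (x' - x); rewrite subrKC.
move: h1 hC hK; rewrite xE addrAC subrr add0r => h1 hC hK.
set y := x + h.
have yL : `|y| <= L by apply: le_trans (ler_normD _ _) _; rewrite xL; lra.
have h0 := normr_ge0 h.
move: sK hK hC; rewrite !ltr_pdivlMr ?mulr_gt0// /K => sK hK hC.
have Dh : 0 <= D * `|h| by rewrite mulr_ge0// ltW.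
have Lh : 0 <= L * `|h| by rewrite mulr_ge0// ltW.
split.
  have -> : Vt t' y - Vt t x = ip (Pdot t' y - Pdot t y) y
      + (ip (Pdot t x) h + ip (Pdot t h) x + ip (Pdot t h) h).
    by rewrite ipBl -quadratic_increment ?/Vt -/y; [ring|exact: Pdot_lin].
  have b1 : `|ip (Pdot t' y - Pdot t y) y| <= e / 2.
    apply: le_trans (ip_le (Hd t' y t'0 sd) (lexx _)) _.
    have -> : e / 2 = e / (2 * L ^+ 2) * L * L by field; rewrite gt_eqF.
    have e1' := ltW e1.
    by apply: ler_pM => //; [exact: mulr_ge0|exact: ler_wpM2l].
  have c1 := ip_le (HD x) (lexx `|h|).
  have c2 := ip_le (HD h) (lexx `|x|).
  have c3 := ip_le (HD h) (lexx `|h|).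
  have b2 : `|ip (Pdot t x) h + ip (Pdot t h) x + ip (Pdot t h) h| <=
      D * `|x| * `|h| + D * `|h| * `|x| + D * `|h| * `|h|.
    apply: le_trans (ler_normD _ _) (lerD _ c3).
    exact: le_trans (ler_normD _ _) (lerD c1 c2).
  apply: le_trans (ler_normD _ _) _; apply: le_trans (lerD b1 b2) _.
  have : D * `|h| * `|h| <= D * `|h| * 1 by rewrite ler_wpM2l// ltW.
  by rewrite xL; lra.
move=> k.
have -> : Vx t' y k - Vx t x k = 2 * ip (P t' y - P t y + P t h) k.
  rewrite /Vx /y [in RHS]ipDl ipBl (bounded_linearD _ _ (P_lin t0)) ipDl.
  by ring.
rewrite normrM ger0_norm//.
have s0 := normr_ge0 (t' - t).
have b1 : `|P t' y - P t y| <= (1 + D) * `|t' - t| * L.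
  have := Hd' (t' - t) y; rewrite subrKC => /(_ t'0 sd'); rewrite mul1r => HE.
  rewrite -[P t' y - P t y](subrK ((t' - t) *: Pdot t y)).
  apply: le_trans (ler_normD _ _) _; rewrite normrZ.
  apply: le_trans (lerD HE (ler_wpM2l s0 (HD y))) _.
  have := ler_wpM2l s0 yL.
  have := ler_wpM2l (mulr_ge0 s0 (ltW D0)) yL.
  by lra.
have b2 : `|P t' y - P t y + P t h| <= e / 2.
  apply: le_trans (ler_normD _ _) _; apply: le_trans (lerD b1 (HC h)) _; lra.
by have := ip_le b2 (lexx `|k|); lra.
Qed.

Lemma quadratic_C1_on_halfspace : C1_on_halfspace V.
Proof.
exists Vt, Vx; split.
- exact: quadratic_Vx_linear.
- exact: quadratic_differentiable.
- exact: quadratic_C1.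
Qed.

End quadratic_form.

(** Dividing the hypothesis by [c] bounds [n ^+ 2] by the sum of the squares of the two summands,
    which is at most the square of their sum. *)
Lemma sqrt_bound (R : realType) (c C n n0 I Z : R) :
  0 < c -> 0 < C -> 0 <= n -> 0 <= n0 -> 0 <= I -> 0 <= Z ->
  c * n ^+ 2 <= C * n0 ^+ 2 / (1 + I) + Z ->
  n <= Num.sqrt (C / c) * n0 / Num.sqrt (1 + I) + Num.sqrt (c^-1 * Z).
Proof.
move=> c0 C0 n_ge0 n0_ge0 I0 Z0 H.
have J0 : 0 < 1 + I by lra.
have q0 : 0 <= C / c by rewrite divr_ge0// ltW.
have cZ0 : 0 <= c^-1 * Z by rewrite mulr_ge0// invr_ge0 ltW.
set p := Num.sqrt (C / c) * n0 / Num.sqrt (1 + I); set q := Num.sqrt _.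
have p_ge0 : 0 <= p by rewrite divr_ge0 ?mulr_ge0 ?sqrtr_ge0.
have q_ge0 : 0 <= q by rewrite sqrtr_ge0.
rewrite -(ler_pXn2r (_ : 0 < 2)%N) ?nnegrE ?addr_ge0//.
apply: (@le_trans _ _ (p ^+ 2 + q ^+ 2)).
  rewrite /p /q exprMn exprVn exprMn !sqr_sqrtr// ?(ltW J0)//.
  rewrite -(ler_pM2l c0) (le_trans H)// le_eqVlt; apply/orP; left; apply/eqP.
  by field; rewrite !gt_eqF.
by have := mulr_ge0 p_ge0 q_ge0; lra.
Qed.

(** * The quadratic Lyapunov functional and the stability estimates *)

Section quadratic_Lyapunov.
Variables (R : realType) (X : completeNormedModType R) (U : normedModType R).
Variables (ip : X -> X -> R) (DA : R -> set X) (A : R -> X -> X).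
Variables (F : R -> X -> U -> X) (P Pdot : R -> X -> X) (a1 a2 zeta : R -> R).
Variables (M m1 m2 c C : R).
Hypothesis ipP : is_inner_product ip.
Hypothesis P_lin : forall t : R, 0 <= t -> bounded_linear (P t).
Hypothesis P_sym : forall (t : R) x y, 0 <= t -> ip (P t x) y = ip x (P t y).
Hypotheses (c0 : 0 < c) (C0 : 0 < C).
Hypothesis P_bound : forall (t : R) x, 0 <= t -> `|P t x| <= C * `|x|.
Hypothesis P_coer : forall (t : R) x, 0 <= t -> c * `|x| ^+ 2 <= ip (P t x) x.
Hypothesis Pdot_lin : forall t : R, 0 <= t -> bounded_linear (Pdot t).
Hypothesis P_diff : forall t : R, 0 <= t ->
  forall e : R, 0 < e -> exists2 d : R, 0 < d &
    forall s x, 0 <= t + s -> `|s| < d ->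
      `|P (t + s) x - P t x - s *: Pdot t x| <= e * `|s| * `|x|.
Hypothesis Pdot_cont : forall t : R, 0 <= t ->
  forall e : R, 0 < e -> exists2 d : R, 0 < d &
    forall (s : R) x, 0 <= s -> `|s - t| < d ->
      `|Pdot s x - Pdot t x| <= e * `|x|.
Hypotheses (a1i : nonneg_locint a1) (a2i : nonneg_locint a2).
Hypotheses (a1oo : int_diverges a1) (M0 : 0 <= M).
Hypothesis a21 : forall t : R, 0 <= t -> a2 t <= M * a1 t.
Hypotheses (m1_gt2 : 2 < m1) (m2_gt2 : 2 < m2) (Kzeta : class_K zeta).
Hypothesis dissip : forall (t : R) x w, 0 <= t -> DA t x ->
  ip (P t x) (A t x) + ip (P t (A t x)) x + ip (Pdot t x) x
    + 2 * ip (F t x w) (P t x)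
  <= - a1 t * `|x| ^+ 2 + a2 t * (`|x| `^ m1 + `|x| `^ m2) + zeta `|w|.

Let V (t : R) (x : X) := ip (P t x) x.

Let V_ge0 (t : R) x : 0 <= t -> 0 <= V t x.
Proof.
move=> t0; apply: le_trans (P_coer x t0).
by rewrite mulr_ge0 ?sqr_ge0// ltW.
Qed.

Let V_le (t : R) x : 0 <= t -> V t x <= C * `|x| ^+ 2.
Proof.
move=> t0; apply: le_trans (ler_norm _) _.
by have := ip_le ipP (P_bound x t0) (lexx `|x|); rewrite -mulrA -expr2.
Qed.

Let V_C1 : C1_on_halfspace V.
Proof.
exact: (quadratic_C1_on_halfspace ipP P_lin P_sym Pdot_lin P_diff Pdot_cont).
Qed.

(** [C1_on_halfspace] hides the partial derivatives behind existentials; the derivative along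
    solutions needs the explicit ones. *)
Let Vx_lin := quadratic_Vx_linear ipP P.
Let V_diff := quadratic_differentiable ipP P_lin P_sym Pdot_lin P_diff.
Let V_cont := quadratic_C1 ipP P_lin Pdot_lin P_diff Pdot_cont.

Lemma quadratic_sandwich : LF_sandwich V.
Proof.
split=> //; exists (fun s => c * s ^+ 2), (fun s => C * s ^+ 2).
by split; [exact: class_Kinf_sqr..|move=> t x t0; rewrite P_coer// V_le].
Qed.

(** * Regularity and decay of [V] along a classical solution *)

Section solution.
Variables (x0 : X) (u : R -> U) (x : R -> X).
Hypothesis sol : classical_solution DA A F x0 u x.

Let v r := V r (x r).

Let dx (t : R) : 0 < t -> derivable x t 1.
Proof. by case: sol => _ _ H /H[]. Qed.

Lemma solution_continuous : {within `[0, +oo[, continuous v}.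
Proof.
by case: sol => _ cx _; exact: (comp_within_continuous Vx_lin V_diff cx).
Qed.

Lemma solution_derivable (t : R) : 0 < t -> derivable v t 1.
Proof.
by move=> t0; exact: (comp_derive1 Vx_lin V_diff t0 (dx t0)).1.
Qed.

Lemma solution_derive_continuous (t : R) :
  0 < t -> {for t, continuous (derive1 v)}.
Proof.
move=> t0; apply: (comp_derive1_continuous Vx_lin V_diff V_cont t0 dx).
by case: sol => _ _ /(_ t t0)[].
Qed.

(** The chain rule yields the [Pdot] term and twice the pairing of [P t x] with [A t x + F t x w];
    self-adjointness of [P t] splits the part with [A] into the two terms of [dissip]. *)
Lemma solution_dissipation (t : R) : 0 < t ->
  derive1 v t <=
    - a1 t * `|x t| ^+ 2 + a2 t * (`|x t| `^ m1 + `|x t| `^ m2) + zeta `|u t|.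
Proof.
move=> t0; have [Dx _ _ x'E] : [/\ DA t (x t), derivable x t 1,
    {for t, continuous (derive1 x)} &
    derive1 x t = A t (x t) + F t (x t) (u t)] by case: sol => _ _; exact.
apply: le_trans (dissip (u t) (ltW t0) Dx).
rewrite (comp_derive1 Vx_lin V_diff t0 (dx t0)).2 x'E.
rewrite (ipDr ipP) (P_sym (A t (x t)) _ (ltW t0)) (ipC ipP (A t (x t))).
by rewrite (ipC ipP (F _ _ _)); lra.
Qed.

End solution.

Lemma quadratic_LiISS_LF : LiISS_LF DA A F V.
Proof.
have M1 : 0 < M + 1 by rewrite ltr_wpDl.
split; [exact: V_C1|exact: quadratic_sandwich|].
have [r r0 Hr] := powR_sum_le_sqr M1 m1_gt2 m2_gt2.
(* The factor [M + 1] is moved from [a2] to the powers, so that [g2 <= g1] holds while the product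
   is unchanged; adding [1] allows [M = 0]. *)
exists a1, (fun t => (M + 1)^-1 * a2 t), (fun s => 1 * s ^+ 2),
  (fun s => (M + 1) * (s `^ m1 + s `^ m2)), zeta, r.
split => //.
- by apply: nonneg_locintZ => //; rewrite invr_ge0 ltW.
- move=> t t0; rewrite mulrC ler_pdivrMr// (le_trans (a21 t0))//.
  by have := a1i.1 t t0; lra.
split.
  split=> //.
  - by have [] := class_Kinf_sqr (@ltr01 R).
  - apply: class_K_powR_sum => //; first exact: lt_trans m1_gt2.
    exact: lt_trans m2_gt2.
  - by move=> s s0 sr; rewrite mul1r Hr.
move=> x0 u x _ _ sol t t0; split; first exact: solution_derivable sol _ t0.
apply: le_trans (solution_dissipation sol t0) _; rewrite lerD2r mul1r lerD2l.
by rewrite mulrACA mulVf ?gt_eqF// mul1r.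
Qed.

Lemma quadratic_iISS_LF : (forall t, 0 <= t -> a2 t = 0) -> iISS_LF DA A F V.
Proof.
move=> a20; split; [exact: V_C1|exact: quadratic_sandwich|].
exists a1, (fun s => 1 * s ^+ 2), zeta; split => //.
  by have [] := class_Kinf_sqr (@ltr01 R).
move=> x0 u x _ _ sol t t0; split; first exact: solution_derivable sol _ t0.
apply: le_trans (solution_dissipation sol t0) _.
by rewrite a20 ?(ltW t0)// mul0r addr0 mul1r.
Qed.

(** The factor [C^-1] converts the squared norm into [V]; the factor one half leaves the other half
    of the damping for absorption. *)
Let a r := (2 * C)^-1 * a1 r.

Let ai : nonneg_locint a.
Proof. by apply: nonneg_locintZ => //; rewrite invr_ge0 mulr_ge0// ltW. Qed.

Let aoo : int_diverges a.
Proof. by apply: int_divergesZ => //; rewrite invr_gt0 mulr_gt0. Qed.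

Let beta s t := Num.sqrt (C / c) * s / Num.sqrt (1 + int0 a t).

Let sigma r := Num.sqrt (c^-1 * r).

Let KLbeta : class_KL beta.
Proof. by apply: class_KL_inv_sqrt_int => //; rewrite sqrtr_gt0 divr_gt0. Qed.

Let Ksigma : class_Kinf sigma.
Proof. by apply: class_Kinf_sqrt; rewrite invr_gt0. Qed.

Let a_V (t : R) x : 0 <= t -> a t * V t x <= a1 t / 2 * `|x| ^+ 2.
Proof.
move=> t0; apply: le_trans (ler_wpM2l (ai.1 t t0) (V_le x t0)) _.
rewrite le_eqVlt; apply/orP; left; apply/eqP; rewrite /a.
by field; rewrite gt_eqF.
Qed.

Let bound_norm x0 u x (t : R) : classical_solution DA A F x0 u x ->
  admissible_input u -> 0 <= t ->
  V t (x t) <= V 0 (x 0) / (1 + int0 a t) + int0 (fun r => zeta `|u r|) t ->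
  `|x t| <= beta `|x0| t + sigma (int0 (fun r => zeta `|u r|) t).
Proof.
move=> sol cu t0 H; have I0 := int0_ge0 t ai.
apply: sqrt_bound => //; first exact/int0_ge0/class_K_comp_norm_locint.
apply: le_trans (P_coer (x t) t0) _; apply: le_trans H _; rewrite lerD2r.
rewrite ler_wpM2r ?invr_ge0 ?addr_ge0//.
by case: sol => <- _ _; exact: V_le.
Qed.

Lemma quadratic_LiISS : LiISS DA A F.
Proof.
(* With this factor the [a2] term is at most [a1 / 2] times the squared norm, as long as the norm is
   at most [r]. *)
have M1 : 0 < 2 * (M + 1) by rewrite mulr_gt0// ltr_wpDl.
have [r r0 Hr] := powR_sum_le_sqr M1 m1_gt2 m2_gt2.
(* By coercivity, [V <= rho] forces the norm to be at most [r]. *)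
pose rho := c * r ^+ 2.
have rho0 : 0 < rho by rewrite mulr_gt0// exprn_gt0.
have C1 : 0 < 2 * (C + 1) by rewrite mulr_gt0// addr_gt0.
(* Radius at most [1] gives [|x0| ^+ 2 <= |x0|], so the initial value of [V] plus the input integral
   is at most [C + 1] times the size of the data, hence at most [rho / 2]. *)
exists (Num.min 1 (rho / (2 * (C + 1)))), zeta, zeta, id, sigma, beta.
split.
  by split=> //; [rewrite lt_min ltr01 divr_gt0|exact: class_Kinf_id].
split=> // x0 u x _ cu sol small t t0; apply: bound_norm => //.
have zi := class_K_comp_norm_locint Kzeta cu.
apply: (@comparison_le_sublevel _ (fun r => V r (x r)) _ _ _ _ _ rho) => //.
- exact: solution_continuous sol.
- by move=> s; exact: solution_derivable sol s.
- by move=> s; exact: solution_derive_continuous sol s.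
- by move=> s s0; exact: V_ge0.
- move=> s s0 Vrho; have s0' := ltW s0.
  have xr : `|x s| <= r.
    rewrite -(ler_pXn2r (_ : 0 < 2)%N) ?nnegrE ?(ltW r0)//.
    by rewrite -(ler_pM2l c0) (le_trans (P_coer _ s0')).
  apply: le_trans (solution_dissipation sol s0) _.
  have := a_V (x s) s0'; have := Hr _ (normr_ge0 (x s)) xr.
  have : 0 <= `|x s| `^ m1 + `|x s| `^ m2 by rewrite addr_ge0// powR_ge0.
  move: (`|x s| `^ m1 + `|x s| `^ m2) (V s (x s)) (zeta _) => p w z p0 Hp aV.
  have := ler_wpM2r p0 (a21 s0').
  have := ler_wpM2l (a1i.1 s s0') Hp.
  have := mulr_ge0 (a1i.1 s s0') p0.
  by move: aV; lra.
- move=> s s0.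
  have small1 : `|x0| + int0 (fun r => zeta `|u r|) s
      <= Num.min 1 (rho / (2 * (C + 1))).
    (* Smallness is available only at positive times; using it at [s + 1] also covers [s = 0], since
       the integral is nondecreasing. *)
    have := small (s + 1); rewrite ltr_wpDl// => /(_ erefl).
    by apply: le_trans; rewrite lerD2l le_int0// lerDl.
  have V0 : V 0 (x 0) <= C * `|x0| ^+ 2 by case: sol => <- _ _; exact: V_le.
  have Z0 := int0_ge0 s zi; have n0 := normr_ge0 x0.
  move: small1; rewrite le_min ler_pdivlMr// => /andP[n1 nr].
  have : `|x0| ^+ 2 <= `|x0| by rewrite expr2 ler_piMr//; lra.
  move=> /(ler_wpM2l (ltW C0)).
  have := mulr_ge0 (ltW C0) Z0; have := mulr_ge0 (ltW C0) n0.
  by move: (int0 _ s) Z0 n1 nr V0 => Z Z0 n1 nr V0; lra.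
Qed.

Lemma quadratic_iISS : (forall t, 0 <= t -> a2 t = 0) -> iISS DA A F.
Proof.
move=> a20; exists zeta, sigma, beta; split=> // x0 u x _ cu sol t t0.
apply: bound_norm => //.
have zi := class_K_comp_norm_locint Kzeta cu.
(* With [a2 = 0] nothing has to be absorbed, so the differential inequality holds at every level and
   no bootstrapping is required. *)
apply: (@comparison_le _ (fun r => V r (x r)) _ _ _ _ _ t) => //.
- exact: solution_continuous sol.
- by move=> s; exact: solution_derivable sol s.
- by move=> s; exact: solution_derive_continuous sol s.
- by move=> s s0; exact: V_ge0.
- move=> s s0 _; have s0' := ltW s0.
  apply: le_trans (solution_dissipation sol s0) _.
  rewrite a20// mul0r addr0; have := a_V (x s) s0'.
  by have := mulr_ge0 (a1i.1 s s0') (sqr_ge0 `|x s|); lra.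
Qed.

End quadratic_Lyapunov.

Unset Implicit Arguments.

Theorem theorem3p5
  (R : realType) (X : completeNormedModType R) (U : normedModType R)
  (ip : X -> X -> R)
  (DA : R -> set X) (A : R -> X -> X) (F : R -> X -> U -> X)
  (P Pdot : R -> X -> X) (a1 a2 zeta : R -> R) (M m1 m2 : R) :
  is_inner_product ip ->
  (* standing assumptions: A(t) with domain D(A(t)) generates an analytic
     semigroup, and is linear on its (linear) domain *)
  (forall t, 0 <= t -> generates_analytic_semigroup (DA t) (A t)) ->
  (* P(t) in L(X), self-adjoint, positive definite *)
  (forall t, 0 <= t -> bounded_linear (P t)) ->
  (forall t x y, 0 <= t -> ip (P t x) y = ip x (P t y)) ->
  (forall t x, 0 <= t -> x != 0 -> 0 < ip (P t x) x) ->
  (* uniformly bounded and uniformly coercive *)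
  (exists c, forall t x, 0 <= t -> `|P t x| <= c * `|x|) ->
  (exists2 c, 0 < c & forall t x, 0 <= t -> c * `|x| ^+ 2 <= ip (P t x) x) ->
  (* P continuously differentiable on [0,+oo) in operator norm, with
     derivative Pdot (one-sided at t = 0) *)
  (forall t, 0 <= t -> bounded_linear (Pdot t)) ->
  (forall t, 0 <= t -> forall e : R, 0 < e -> exists2 d : R, 0 < d &
     forall s x, 0 <= t + s -> `|s| < d ->
       `|P (t + s) x - P t x - s *: Pdot t x| <= e * `|s| * `|x|) ->
  (forall t, 0 <= t -> forall e : R, 0 < e -> exists2 d : R, 0 < d &
     forall s x, 0 <= s -> `|s - t| < d ->
       `|Pdot s x - Pdot t x| <= e * `|x|) ->
  (* a1, a2 *)
  nonneg_locint a1 -> nonneg_locint a2 -> int_diverges a1 ->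
  0 <= M -> (forall t, 0 <= t -> a2 t <= M * a1 t) ->
  2 < m1 -> 2 < m2 -> class_K zeta ->
  (* the dissipation inequality; <A^*(t)P(t)x, x> is read as <P(t)x, A(t)x> *)
  (forall t x w, 0 <= t -> DA t x ->
     ip (P t x) (A t x) + ip (P t (A t x)) x + ip (Pdot t x) x
       + 2 * ip (F t x w) (P t x)
     <= - a1 t * `|x| ^+ 2 + a2 t * (`|x| `^ m1 + `|x| `^ m2) + zeta `|w|) ->
  let V := fun t x => ip (P t x) x in
  [/\ LiISS_LF DA A F V, LiISS DA A F &
      ((forall t, 0 <= t -> a2 t = 0) -> iISS_LF DA A F V /\ iISS DA A F)].
Proof.
move=> ipP _ P_lin P_sym _ [c' P_bound] [c c0 P_coer] Pdot_lin P_diff Pdot_cont.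
move=> a1i a2i a1oo M0 a21 m1_gt2 m2_gt2 Kzeta dissip V.
have C0 : 0 < `|c'| + 1 by rewrite ltr_pwDr.
have P_bound' t x : 0 <= t -> `|P t x| <= (`|c'| + 1) * `|x|.
  move=> t0; apply: le_trans (P_bound t x t0) _; rewrite ler_wpM2r//.
  by have := ler_norm c'; lra.
split.
- exact: (quadratic_LiISS_LF ipP P_lin P_sym c0 C0 P_bound' P_coer Pdot_lin
    P_diff Pdot_cont a1i a2i a1oo M0 a21 m1_gt2 m2_gt2 Kzeta dissip).
- exact: (quadratic_LiISS ipP P_lin P_sym c0 C0 P_bound' P_coer Pdot_lin
    P_diff Pdot_cont a1i a1oo M0 a21 m1_gt2 m2_gt2 Kzeta dissip).
- move=> a20; split.
    exact: (quadratic_iISS_LF ipP P_lin P_sym c0 C0 P_bound' P_coer Pdot_lin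
      P_diff Pdot_cont a1i a1oo Kzeta dissip a20).
  exact: (quadratic_iISS ipP P_lin P_sym c0 C0 P_bound' P_coer Pdot_lin
    P_diff Pdot_cont a1i a1oo Kzeta dissip a20).
Qed.
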